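(* Consider the contextual bilateral trade problem in the two-bit feedback model. There exists an efficiency-maximizing (i.e., gain-from-trade-maximizing) algorithm that achieves regret $O(d \log d)$ and enforces per-round budget balance.
   Context: Contextual bilateral trade: Let $\mathbb{B}=\{w\in\mathbb{R}^d:\|w\|_2\le 1\}$. There are two fixed vectors $s,b\in\mathbb{B}$ unknown to the learner. At each time $t=1,\dots,T$, the learner observes a context $x_t\in\mathbb{B}$ (the sequence of contexts, together with $s,b$, is fixed in advance by an oblivious adversary; this triple is an instance), and posts a price $p_t$ to the seller and $q_t$ to the buyer. The valuations are $s_t=\langle s,x_t\rangle$ and $b_t=\langle b,x_t\rangle$; the trade happens iff $s_t\le p_t$ and $q_t\le b_t$. Gain from trade: $\mathrm{GFT}_t(p_t,q_t)=(b_t-s_t)\,\mathbb{1}\{s_t\le p_t\}\mathbb{1}\{q_t\le b_t\}$. Profit: $\mathrm{Profit}_t(p_t,q_t)=(q_t-p_t)\,\mathbb{1}\{s_t\le p_t\}\mathbb{1}\{q_t\le b_t\}$. Two-bit feedback: after each round the learner observes $(\mathbb{1}\{s_t\le p_t\},\mathbb{1}\{q_t\le b_t\})$. The regret of a (possibly randomized) efficiency-maximizing algorithm $\mathcal{A}$ is $R_T(\mathcal{A})=\sup_{\mathcal{I}}\mathbb{E}\big[\sum_{t=1}^T (b_t-s_t)_+-\sum_{t=1}^T\mathrm{GFT}_t(p_t,q_t)\big]$, where the supremum is over instances and the expectation over the algorithm's randomness. Per-round budget balance means $p_t\le q_t$ for every $t$. The $O(\cdot)$ hides absolute constants (independent of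 $d$ and $T$). *)

(* Defs.v *)
From HB Require Import structures.
From mathcomp Require Import all_boot all_order all_algebra.
From mathcomp Require Import all_classical all_reals all_analysis.
Set Implicit Arguments. Unset Strict Implicit. Unset Printing Implicit Defensive.
Import Order.TTheory GRing.Theory Num.Theory.
Local Open Scope ring_scope.

Section ContextualBilateralTrade.
Variables (R : realType) (d : nat).

Definition dotp (u v : 'rV[R]_d) : R := \sum_(i < d) u ord0 i * v ord0 i.
Definition norm2 (u : 'rV[R]_d) : R := Num.sqrt (dotp u u).
Definition in_ball (u : 'rV[R]_d) : Prop := norm2 u <= 1.

Definition feedback (st bt p q : R) : bool * bool := (st <= p, q <= bt).

(* A deterministic policy: given the history (past contexts together with the
   two-bit feedbacks observed) and the current context, post the prices
   (p_t, q_t) (p_t to the seller, q_t to the buyer). *)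
Definition history := seq ('rV[R]_d * (bool * bool)).
Definition policy := history -> 'rV[R]_d -> R * R.

(* History available at round t (rounds indexed from 0), when the policy is
   run on the instance (s, b, x). *)
Fixpoint hist (pol : policy) (s b : 'rV[R]_d) (x : nat -> 'rV[R]_d) (t : nat)
  : history :=
  match t with
  | 0 => [::]
  | t'.+1 =>
      let h := hist pol s b x t' in
      let pq := pol h (x t') in
      rcons h (x t', feedback (dotp s (x t')) (dotp b (x t')) pq.1 pq.2)
  end.

Definition prices (pol : policy) (s b : 'rV[R]_d) (x : nat -> 'rV[R]_d) (t : nat)
  : R * R := pol (hist pol s b x t) (x t).

Definition GFT (st bt p q : R) : R :=
  (bt - st) * (if (st <= p) && (q <= bt) then 1 else 0).

Definition inst_regret (pol : policy) (s b : 'rV[R]_d) (x : nat -> 'rV[R]_d)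
  (t : nat) : R :=
  let st := dotp s (x t) in
  let bt := dotp b (x t) in
  let pq := prices pol s b x t in
  Num.max (bt - st) 0 - GFT st bt pq.1 pq.2.

Definition total_regret (pol : policy) (s b : 'rV[R]_d) (x : nat -> 'rV[R]_d)
  (T : nat) : R := \sum_(t < T) inst_regret pol s b x t.

End ContextualBilateralTrade.

(* Main.v *)
Require Import Defs.
From HB Require Import structures.
From mathcomp Require Import all_boot all_order all_algebra.
From mathcomp Require Import all_classical all_reals all_analysis.
From mathcomp Require Import measurable_realfun ring lra.
Import Order.TTheory GRing.Theory Num.Theory.
Local Open Scope ring_scope.

(** The policy is deterministic and posts a single price [p = q].  It keeps, for
    each of [s] and [b], the list of half-spaces revealed so far.  For a list [K]
    and a margin [z > 0], let [body z K] be the ball of radius [1 + z] cut by the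
    half-spaces of [K], each relaxed by [z]; it contains a ball of radius [z]
    around the hidden vector, so its volume stays between [z ^ d] and
    [(1 + z) ^ d] times that of the unit ball.

    If [body 0 K] has width [w] in direction [x] and [32 * d * z <= w], a slab of
    thickness [3 * z] orthogonal to [x] holds at most a quarter of the volume of
    [body z K] (shrink the body towards a point that is far from the slab).  Hence
    a price near the median of [body z K] multiplies its volume by at most [3/4],
    whatever the answer is.

    Say that the body of [b] is at least as wide as that of [s].  The price is then
    the median of the body of [b], clamped from below by the least possible value
    of [b_t] and from above by the greatest possible value of [s_t].  If the trade
    is lost, the loss is at most the width [w] of the body of [b], and the volume
    of that body drops by the factor [3/4] at the margin [z] attached to [w].  The
    case of a wider body of [s] is symmetric.  For each dyadic width [2^-i] this
    happens [O(d * ln (d * 2^i))] times, and summing [2^-i] times this number over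
    [i] gives [O(d * ln d)]. *)

Set Implicit Arguments.
Unset Strict Implicit.
Unset Printing Implicit Defensive.

(** * Lebesgue measure on tuples of reals *)

Section SigmaFinite.
Local Open Scope classical_set_scope.
Local Open Scope ring_scope.
Variables (d : measure_display) (T : measurableType d) (R : realType).
Variables (m : {measure set T -> \bar R}) (h : sigma_finite setT m).

(** An alias of [m] that carries the proof [h], so that a sigma-finite structure can be attached to
    a measure only proved to be sigma-finite. *)
Definition with_sigma_finite of sigma_finite setT m : set T -> \bar R := m.

HB.instance Definition _ := Measure.on (with_sigma_finite h).
HB.instance Definition _ :=
  @Measure_isSigmaFinite.Build d T R (with_sigma_finite h) h.

End SigmaFinite.

Section Volume.
Local Open Scope classical_set_scope.
Local Open Scope ring_scope.
Variable R : realType.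
Local Notation mR := (measurableTypeR R).

Definition affine_tuple n (l : R) (v y : n.-tuple mR) : n.-tuple mR :=
  [tuple l * tnth y i + tnth v i | i < n].

Lemma measurable_affine (l c : R) :
  measurable_fun setT (fun t : mR => l * t + c : mR).
Proof.
apply: measurable_funD; last exact: measurable_cst.
exact: measurable_funM.
Qed.

Lemma measurable_affine_tuple n (l : R) (v : n.-tuple mR) :
  measurable_fun setT (affine_tuple l v).
Proof.
apply/measurable_fun_tnthP => i.
rewrite (_ : _ \o _ =
  (fun t : mR => l * t + tnth v i : mR) \o (@tnth n mR ^~ i)).
  by apply: measurableT_comp; [exact: measurable_affine|exact: measurable_tnth].
by apply/funext => y /=; rewrite tnth_mktuple.
Qed.

(** By uniqueness of Lebesgue measure: [l] times the pushforward along the affine map gives each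
    half-open interval its length. *)
Lemma lebesgue_affine (l c : R) (A : set mR) : 0 < l -> measurable A ->
  lebesgue_measure ((fun t : mR => l * t + c : mR) @^-1` A) =
  ((l^-1)%:E * lebesgue_measure A)%E.
Proof.
move=> l0 mA.
set f := fun t : mR => l * t + c : mR.
have mf : measurable_fun setT f := measurable_affine l c.
pose m : {measure set mR -> \bar R} := pushforward lebesgue_measure f.
have := @lebesgue_measure_unique R (mscale (NngNum (ltW l0)) (m mf)) _ A mA.
rewrite /= /mscale /=  => ->; last first.
  move=> X [[a b]] /= _ <-; rewrite /mscale /= /pushforward /=.
  have -> : f @^-1` `]a, b]%classic = `](a - c) / l, (b - c) / l]%classic.
    apply/seteqP; split => t /=;
    rewrite !in_itv /= /f ltr_pdivrMr // ler_pdivlMr //;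
    move=> /andP[h1 h2]; apply/andP; split; lra.
  rewrite !lebesgue_measure_itv /= !lte_fin.
  rewrite ltr_pM2r ?invr_gt0 // ltrD2r; case: ifP => _; last by rewrite mule0.
  by rewrite -!EFinD -EFinM; congr EFin; field; rewrite gt_eqF.
by rewrite muleA -EFinM mulVf ?gt_eqF // mul1e.
Qed.

Lemma integral_affine (l c : R) (g : mR -> \bar R) : 0 < l ->
  measurable_fun setT g -> (forall t, 0 <= g t)%E ->
  (\int[lebesgue_measure]_t g (l * t + c)%R =
  (l^-1)%:E * \int[lebesgue_measure]_t g t)%E.
Proof.
move=> l0 mg g0.
set f := fun t : mR => l * t + c : mR.
have mf : measurable_fun setT f := measurable_affine l c.
have := ge0_integral_pushforward mf lebesgue_measure measurableT mg
  (fun y _ => g0 y).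
rewrite preimage_setT => <-.
have li0 : 0 <= l^-1 by rewrite invr_ge0 ltW.
rewrite -(ge0_integral_mscale lebesgue_measure measurableT (NngNum li0) mg) //.
apply: eq_measure_integral => A mA _.
by rewrite /= /pushforward lebesgue_affine.
Qed.

(** Scaling under homotheties is what the volume estimates rest on; the value on the cube only
    serves to make the unit ball of positive and finite measure. *)
Definition is_volume n (mu : set (n.-tuple mR) -> \bar R) :=
  (forall l v A, 0 < l -> measurable A ->
     mu (affine_tuple l v @^-1` A) = ((l^-1 ^+ n)%:E * mu A)%E) /\
  mu [set y | forall i, `|tnth y i| <= 1] = (2 ^+ n)%:E.

Lemma measurable_cube n (r : R) :
  measurable [set y : n.-tuple mR | forall i, `|tnth y i| <= r].
Proof.
rewrite (_ : [set _ | _] =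
  \bigcap_(i in [set: 'I_n]) ((@tnth n mR ^~ i) @^-1` `[-r, r]%classic)).
  apply: fin_bigcap_measurable => // i _.
  by rewrite -[X in measurable X]setTI; exact: measurable_tnth.
apply/seteqP; split => y /= h i; last first.
  by have := h i Logic.I; rewrite /= in_itv /= ler_norml.
by move=> _ /=; rewrite in_itv /= -ler_norml.
Qed.

Lemma is_volume_sigma_finite n (mu : {measure set (n.-tuple mR) -> \bar R}) :
  is_volume mu -> sigma_finite setT mu.
Proof.
move=> [muA mu1].
exists (fun k => [set y | forall i, `|tnth y i| <= k.+1%:R]).
  apply/seteqP; split => // y _.
  exists (Num.truncn (\sum_i `|tnth y i|)) => // i.
  apply: ltW; apply: le_lt_trans (truncnS_gt _).
  by rewrite (bigD1 i) //= lerDl sumr_ge0.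
move=> k; split; first exact: measurable_cube.
have k0 : (0 : R) < k.+1%:R^-1 by rewrite invr_gt0.
have := muA _ [tuple 0 | i < n] _ k0 (@measurable_cube n 1).
rewrite mu1 -EFinM (_ : _ @^-1` _ = [set y | forall i, `|tnth y i| <= k.+1%:R]).
  by move=> ->; rewrite ltry.
apply/seteqP; split => y /= h i; have := h i;
rewrite !tnth_mktuple addr0 normrM (gtr0_norm k0) mulrC;
by rewrite ler_pdivrMr // mul1r.
Qed.

(** Induction on the dimension: the product of Lebesgue measure with [mu], transported along [cns].
    Sigma-finiteness belongs to the induction because slices must have measurable volume. *)
Lemma volume_exists n :
  exists mu : {sigma_finite_measure set (n.-tuple mR) -> \bar R}, is_volume mu.
Proof.
elim: n => [|n [mu [muA mu1]]].
  exists (\d_([tuple] : 0.-tuple mR)); split.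
    move=> l v A _ _; rewrite expr0 mul1e /= !diracE; congr (_%:R%:E).
    congr (nat_of_bool _); apply/idP/idP; rewrite !inE /=;
    by rewrite (tuple0 (affine_tuple _ _ _)).
  by rewrite expr0 /= diracE mem_set // => -[].
pose cns (p : mR * n.-tuple mR) : n.+1.-tuple mR :=
  [the n.+1.-tuple mR of p.1 :: p.2].
have mcns : measurable_fun setT cns by apply: measurable_cons.
pose pm : {measure set (mR * n.-tuple mR)%type -> \bar R} :=
  (lebesgue_measure \x mu)%E.
pose nu0 : {measure set (n.+1.-tuple mR) -> \bar R} := pushforward pm cns.
pose nu := nu0 mcns.
have nuE A : measurable A ->
    nu A = (\int[lebesgue_measure]_t mu [set y | A (cns (t, y))])%E.
  move=> mA; rewrite /nu /= /pushforward /= /product_measure1.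
  apply: eq_integral => t _ /=; congr (mu _).
  by apply/seteqP; split => y /=; rewrite /xsection /= inE.
suff nuV : is_volume nu.
  by exists (with_sigma_finite (is_volume_sigma_finite nuV)).
split.
  move=> l v A l0 mA.
  have mA' : measurable (affine_tuple l v @^-1` A).
    by rewrite -[X in measurable X]setTI; exact: measurable_affine_tuple.
  rewrite !nuE //.
  have mB : measurable (cns @^-1` A).
    by rewrite -[X in measurable X]setTI; exact: (mcns measurableT).
  pose g (t : mR) := mu [set y | A (cns (t, y))].
  have mg : measurable_fun setT g.
    have := measurable_fun_xsection mu mB; congr (measurable_fun _ _).
    apply/funext => t /=; congr (mu _).
    by apply/seteqP; split => y /=; rewrite /xsection /= inE.
  have mS t : measurable [set y | A (cns (t, y))].
    have := measurable_xsection t mB; congr measurable.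
    by apply/seteqP; split => y /=; rewrite /xsection /= inE.
  (* A slice of the preimage is the preimage of the slice at [l * t + tnth v ord0] under a homothety
     in dimension [n]; integrating over [t] then gives the last factor [l^-1]. *)
  have eg t : mu [set y | (affine_tuple l v @^-1` A) (cns (t, y))] =
      ((l^-1 ^+ n)%:E * g (l * t + tnth v ord0)%R)%E.
    rewrite /g -(muA l [tuple of behead v] _ l0 (mS _)); congr (mu _).
    have E y : affine_tuple l v (cns (t, y)) =
        cns ((l * t + tnth v ord0)%R, affine_tuple l [tuple of behead v] y).
      apply/eq_from_tnth => i; case: (unliftP ord0 i) => [j|] ->.
        rewrite tnth_mktuple !tnthS tnth_mktuple; congr (_ * _ + _).
        by rewrite [in LHS](tuple_eta v) tnthS.
      by rewrite tnth_mktuple !tnth0.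
    by apply/seteqP; split => y /=; rewrite E.
  under eq_integral do rewrite eg.
  rewrite ge0_integralZl //; last 2 first.
  - exact: (measurableT_comp mg (measurable_affine l (tnth v ord0))).
  - by rewrite lee_fin exprn_ge0 // invr_ge0 ltW.
  rewrite integral_affine //.
  by rewrite muleA -EFinM exprSr.
rewrite /nu /= /pushforward.
have -> : cns @^-1` [set y | forall i, `|tnth y i| <= 1] =
    `[-1, 1]%classic `*` [set y : n.-tuple mR | forall i, `|tnth y i| <= 1].
  apply/seteqP; split => -[a y] /=.
    move=> h; split; first by rewrite in_itv /= -ler_norml; exact: (h ord0).
    by move=> i; have := h (lift ord0 i); rewrite tnthS.
  move=> [a1 h] i; case: (unliftP ord0 i) => [j|] ->; first by rewrite tnthS.
  by rewrite tnth0 ler_norml; move: a1; rewrite in_itv.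
rewrite /pm /= product_measure1E //; last exact: measurable_cube.
rewrite mu1 [X in (X * _)%E](lebesgue_measure_itv `[-1, 1]) /= lte_fin.
by rewrite (lt_trans (ltrN10 R) ltr01) exprS -EFinD -EFinM opprK.
Qed.

End Volume.

(** * Volumes of sets of row vectors *)

Section DotProduct.
Variables (R : realType) (d : nat).
Implicit Types u v w : 'rV[R]_d.

Lemma dotpC u v : dotp u v = dotp v u.
Proof. by apply: eq_bigr => i _; rewrite mulrC. Qed.

Lemma dotpDr u v w : dotp u (v + w) = dotp u v + dotp u w.
Proof. by rewrite -big_split; apply: eq_bigr => i _; rewrite mxE mulrDr. Qed.

Lemma dotpZr u (a : R) v : dotp u (a *: v) = a * dotp u v.
Proof. by rewrite mulr_sumr; apply: eq_bigr => i _; rewrite mxE mulrCA. Qed.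

Lemma dotpNr u v : dotp u (- v) = - dotp u v.
Proof. by rewrite -scaleN1r dotpZr mulN1r. Qed.

Lemma dotpDl u v w : dotp (v + w) u = dotp v u + dotp w u.
Proof. by rewrite dotpC dotpDr !(dotpC u). Qed.

Lemma dotpZl u (a : R) v : dotp (a *: v) u = a * dotp v u.
Proof. by rewrite dotpC dotpZr dotpC. Qed.

Lemma dotpNl u v : dotp (- v) u = - dotp v u.
Proof. by rewrite dotpC dotpNr dotpC. Qed.

Lemma dotp_ge0 u : 0 <= dotp u u.
Proof. by apply: sumr_ge0 => i _; rewrite -expr2 sqr_ge0. Qed.

(** Expand the square of [a *: u - v]. This replaces Cauchy-Schwarz without square roots: [a = 1]
    suits two unit vectors, [a = 2] a unit vector against one of norm at most [2]. *)
Lemma dotp_le_sqr u v (a : R) : 0 < a ->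
  dotp u v <= (a * dotp u u + a^-1 * dotp v v) / 2.
Proof.
move=> a0; have := dotp_ge0 (a *: u - v).
rewrite !(dotpDr, dotpDl, dotpNr, dotpNl, dotpZl, dotpZr) (dotpC v u) => h.
have -> : a * dotp u u + a^-1 * dotp v v =
  a^-1 * (a * (a * dotp u u) + dotp v v) by field; rewrite gt_eqF.
rewrite ler_pdivlMr // -(ler_pM2l a0) mulVKf ?gt_eqF //.
lra.
Qed.

Lemma in_ballE u : in_ball u <-> dotp u u <= 1.
Proof.
rewrite /in_ball /norm2; split => h; last by rewrite -sqrtr1 ler_wsqrtr.
by rewrite -ler_sqrt // sqrtr1.
Qed.

Lemma dotp_ball u v : dotp u u <= 1 -> dotp v v <= 1 -> dotp u v <= 1.
Proof.
by move=> hu hv; have := @dotp_le_sqr u v 1 ltr01; rewrite invr1; lra.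
Qed.

End DotProduct.

Section Bodies.
Local Open Scope classical_set_scope.
Local Open Scope ring_scope.
Variables (R : realType) (d : nat).
Local Notation mR := (measurableTypeR R).
Variables (mu : {measure set (d.-tuple mR) -> \bar R}) (muV : is_volume mu).
Implicit Types (A B : set 'rV[R]_d) (x y v : 'rV[R]_d).

Definition row_of (t : d.-tuple mR) : 'rV[R]_d := \row_i (tnth t i : R).

Definition measurable_rV A := measurable (row_of @^-1` A).

(** [fine] sends infinity to [0], so this is a true volume only on sets of finite measure; hence the
    boundedness hypotheses below. *)
Definition rV_volume A : R := fine (mu (row_of @^-1` A)).
Local Notation vol := rV_volume.

Definition cball v (r : R) : set 'rV[R]_d :=
  [set y | dotp (y - v) (y - v) <= r ^+ 2].

Lemma measurable_dotp (f g : d.-tuple mR -> 'rV[R]_d) :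
  (forall i, measurable_fun setT (fun t => f t ord0 i)) ->
  (forall i, measurable_fun setT (fun t => g t ord0 i)) ->
  measurable_fun setT (fun t => dotp (f t) (g t)).
Proof.
move=> mf mg; rewrite /dotp.
by apply: measurable_sum => i; exact: measurable_funM.
Qed.

Lemma measurable_row_of i : measurable_fun setT (fun t => row_of t ord0 i).
Proof.
rewrite (_ : (fun t => _) = (@tnth d mR ^~ i)); first exact: measurable_tnth.
by apply/funext => t; rewrite mxE.
Qed.

Lemma measurable_rV_le x (q : R) : measurable_rV [set y | dotp x y <= q].
Proof.
rewrite /measurable_rV (_ : _ @^-1` _ =
  (fun t => dotp x (row_of t)) @^-1` `]-oo, q]%classic); last first.
  by apply/seteqP; split => t /=; rewrite in_itv.
rewrite -[X in measurable X]setTI; apply: measurable_dotp => // i.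
exact: measurable_row_of.
Qed.

Lemma measurable_rVI A B :
  measurable_rV A -> measurable_rV B -> measurable_rV (A `&` B).
Proof.
by move=> mA mB; rewrite /measurable_rV preimage_setI; exact: measurableI.
Qed.

Lemma measurable_rV_gt x (q : R) : measurable_rV [set y | q < dotp x y].
Proof.
rewrite /measurable_rV (_ : _ @^-1` _ =
  ~` (row_of @^-1` [set y | dotp x y <= q])).
  by apply: measurableC; exact: measurable_rV_le.
by apply/seteqP; split => t /=; rewrite ltNge => /negP.
Qed.

Lemma measurable_rV_ball v r : measurable_rV (cball v r).
Proof.
rewrite /measurable_rV (_ : _ @^-1` _ =
   (fun t => dotp (row_of t - v) (row_of t - v)) @^-1`
     `]-oo, r ^+ 2]%classic); last first.
  by apply/seteqP; split => t /=; rewrite in_itv.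
rewrite -[X in measurable X]setTI.
have mB i : measurable_fun setT (fun t => (row_of t - v) ord0 i).
  rewrite (_ : (fun t => _) = (fun t => row_of t ord0 i - v ord0 i)).
    by apply: measurable_funB; [exact: measurable_row_of|exact: measurable_cst].
  by apply/funext => t; rewrite !mxE.
by apply: measurable_dotp.
Qed.

Lemma row_of_affine (l : R) v t :
  row_of (affine_tuple l [tuple v ord0 i | i < d] t) = l *: row_of t + v.
Proof. by apply/rowP => i; rewrite !mxE !tnth_mktuple. Qed.

Lemma mu_homothety (l : R) v A : 0 < l -> measurable_rV A ->
  mu (row_of @^-1` [set y | A (l *: y + v)]) =
  ((l^-1 ^+ d)%:E * mu (row_of @^-1` A))%E.
Proof.
move=> l0 mA; have [muA _] := muV.
rewrite -(muA l [tuple v ord0 i | i < d] _ l0 mA); congr (mu _).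
by apply/seteqP; split => t /=; rewrite row_of_affine.
Qed.

Lemma mu_cball v r : 0 < r -> mu (row_of @^-1` (cball v r)) =
  ((r ^+ d)%:E * mu (row_of @^-1` (cball 0 1)))%E.
Proof.
move=> r0.
have := @mu_homothety r^-1 (- (r^-1 *: v)) _ _ (measurable_rV_ball 0 1).
rewrite invrK invr_gt0 => /(_ r0) <-; congr (mu _).
suff -> : cball v r = [set y | cball 0 1 (r^-1 *: y - r^-1 *: v)] by [].
apply/seteqP; split => y; rewrite /cball /= subr0 -scalerBr dotpZl dotpZr;
rewrite mulrA -invfM -expr2;
by rewrite expr1n mulrC ler_pdivrMr ?exprn_gt0 // mul1r.
Qed.

Lemma mu_unit_ball_fin : (mu (row_of @^-1` (cball 0 1)) < +oo)%E.
Proof.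
have [_ mu1] := muV.
apply: (@le_lt_trans _ _ (2 ^+ d)%:E); last by rewrite ltry.
rewrite -mu1; apply: le_measure; rewrite ?inE.
- exact: measurable_rV_ball.
- exact: measurable_cube.
move=> t; rewrite /cball /= subr0 expr1n => h i.
rewrite -(@ler_pXn2r _ 2) // ?nnegrE // expr1n real_normK ?num_real //.
apply: le_trans h; rewrite /dotp (bigD1 i) //= !mxE -expr2 lerDl.
by apply: sumr_ge0 => j _; rewrite -expr2 sqr_ge0.
Qed.

(** The cube shrunk by [d.+1] fits in the ball: its squared coordinates are at most [d.+1%:R^-1] and
    there are [d] of them. Using [d.+1] covers dimension [0] as well. *)
Lemma mu_unit_ball_gt0 : (0 < mu (row_of @^-1` (cball 0 1)))%E.
Proof.
have [muA mu1] := muV.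
have d0 : (0 : R) < d.+1%:R by [].
pose v0 : d.-tuple mR := [tuple 0 | i < d].
pose cube : set (d.-tuple mR) := [set y | forall i, `|tnth y i| <= 1].
have : (0 < mu (affine_tuple d.+1%:R v0 @^-1` cube))%E.
  rewrite muA //; last exact: measurable_cube.
  by rewrite mu1 -EFinM lte_fin mulr_gt0 // exprn_gt0 // invr_gt0.
move=> /lt_le_trans; apply; apply: le_measure; rewrite ?inE.
- rewrite -[X in measurable X]setTI; apply: measurable_affine_tuple => //.
  exact: measurable_cube.
- exact: measurable_rV_ball.
move=> t /= h; rewrite /cball /= subr0 expr1n /dotp.
have hi i : row_of t ord0 i * row_of t ord0 i <= d.+1%:R^-1.
  have := h i; rewrite !mxE !tnth_mktuple addr0 normrM gtr0_norm // mulrC.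
  rewrite -ler_pdivlMr // div1r => {}h.
  rewrite -expr2 -real_normK ?num_real // expr2.
  apply: (@le_trans _ _ (d.+1%:R^-1 * 1)); last by rewrite mulr1.
  apply: ler_pM => //; apply: (le_trans h).
  by rewrite invf_le1 // ler1n.
apply: (@le_trans _ _ (\sum_(i < d) d.+1%:R^-1)); first exact: ler_sum.
rewrite sumr_const card_ord -[leLHS]mulr_natl ler_pdivrMr // mul1r ler_nat //.
Qed.

(** Radius [2] is enough, since every margin used is at most [1]. *)
Definition bounded2 A := A `<=` cball 0 2.

Lemma mu_fin A : measurable_rV A -> bounded2 A -> (mu (row_of @^-1` A) < +oo)%E.
Proof.
move=> mA bA; apply: (@le_lt_trans _ _ (mu (row_of @^-1` (cball 0 2)))).
  by apply: le_measure; rewrite ?inE //; [exact: measurable_rV_ball|move=> t /bA].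
rewrite mu_cball //; apply: lte_mul_pinfty => //.
exact: mu_unit_ball_fin.
Qed.

Lemma volE A : measurable_rV A -> bounded2 A ->
  mu (row_of @^-1` A) = (vol A)%:E.
Proof.
move=> mA bA; rewrite /rV_volume fineK // ge0_fin_numE; last exact: measure_ge0.
exact: mu_fin.
Qed.

Lemma vol_ge0 A : 0 <= vol A.
Proof. by rewrite /rV_volume fine_ge0. Qed.

Lemma vol_unit_ball_gt0 : 0 < vol (cball 0 1).
Proof. by rewrite /rV_volume fine_gt0 // mu_unit_ball_gt0 mu_unit_ball_fin. Qed.

Lemma vol_cball v r : 0 < r -> vol (cball v r) = r ^+ d * vol (cball 0 1).
Proof.
move=> r0; rewrite /rV_volume mu_cball // fineM //.
by rewrite ge0_fin_numE; [exact: mu_unit_ball_fin|exact: measure_ge0].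
Qed.

Lemma vol_le A B : measurable_rV A -> measurable_rV B -> bounded2 B ->
  A `<=` B -> vol A <= vol B.
Proof.
move=> mA mB bB AB; rewrite -lee_fin -!volE //; last by move=> y /AB /bB.
by apply: le_measure; rewrite ?inE // => t /AB.
Qed.

Lemma vol_split A x (q : R) : measurable_rV A -> bounded2 A ->
  vol A = vol (A `&` [set y | dotp x y <= q]) +
          vol (A `&` [set y | q < dotp x y]).
Proof.
move=> mA bA; have ml := measurable_rVI mA (measurable_rV_le x q).
have mg := measurable_rVI mA (measurable_rV_gt x q).
have bI B : bounded2 (A `&` B) by move=> y [/bA].
apply: EFin_inj; rewrite EFinD -!volE // -measureU //.
- congr (mu _); rewrite -preimage_setU -setIUr.
  suff -> : [set y | dotp x y <= q] `|` [set y | q < dotp x y] = setT.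
    by rewrite setIT.
  apply/seteqP; split => y //= _.
  by case: (leP (dotp x y) q) => h; [left|right].
- apply/seteqP; split => t //= [[_ h1] [_ h2]].
  by move: h1 h2; rewrite /= leNgt => /negP.
Qed.

Lemma vol_homothety (l : R) v A B : 0 < l ->
  measurable_rV A -> measurable_rV B -> bounded2 A -> bounded2 B ->
  (forall y, A y -> B (l *: y + v)) -> l ^+ d * vol A <= vol B.
Proof.
move=> l0 mA mB bA bB AB; rewrite mulrC -ler_pdivlMr ?exprn_gt0 //.
rewrite -lee_fin mulrC EFinM -!volE // -exprVn -(@mu_homothety l v) //.
have mB' : measurable_rV [set y | B (l *: y + v)].
  rewrite /measurable_rV.
  rewrite (_ : _ @^-1` _ =
     affine_tuple l [tuple v ord0 i | i < d] @^-1` (row_of @^-1` B)).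
    rewrite -[X in measurable X]setTI; exact: measurable_affine_tuple.
  by apply/seteqP; split => t /=; rewrite row_of_affine.
by apply: le_measure; rewrite ?inE // => t /AB.
Qed.

End Bodies.

(** * Halving a convex body *)

Lemma bernoulli_ineq (R : realType) (t : R) n : 0 <= t <= 1 ->
  1 - n%:R * t <= (1 - t) ^+ n.
Proof.
move=> /andP[t0 t1]; elim: n => [|n IH]; first by rewrite mul0r subr0 expr0.
rewrite exprSr; apply: (@le_trans _ _ ((1 - n%:R * t) * (1 - t))).
  rewrite -natr1; have : 0 <= n%:R * (t * t) by rewrite !mulr_ge0.
  by move=> h; lra.
by rewrite ler_wpM2r // subr_ge0.
Qed.

Section Cuts.
Local Open Scope classical_set_scope.
Local Open Scope ring_scope.
Variables (R : realType) (d : nat).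
Local Notation mR := (measurableTypeR R).
Variables (mu : {measure set (d.-tuple mR) -> \bar R}) (muV : is_volume mu).
Implicit Types (L : set 'rV[R]_d) (x y v : 'rV[R]_d).
Implicit Types K : seq ('rV[R]_d * R).
Local Notation vol := (rV_volume mu).

Definition is_convex L := forall a y (l : R), L a -> L y -> 0 <= l <= 1 ->
  L (l *: y + (1 - l) *: a).

(** One of [y1], [y2] is at distance at least [D] from the slab, measured by [dotp x]. Contracting
    towards it moves the far face of the slab onto the near face and keeps [L] inside itself, so
    little volume lies between the faces. *)
Lemma slab_vol L x (q e D : R) y1 y2 :
  measurable_rV L -> bounded2 L -> is_convex L ->
  L y1 -> L y2 -> 0 < e -> 0 < D -> 2 * D + e <= dotp x y2 - dotp x y1 ->
  vol (L `&` [set y | dotp x y <= q + e]) - vol (L `&` [set y | dotp x y <= q])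
    <= d%:R * e / D * vol L.
Proof.
move=> mL bL cL L1 L2 e0 D0 hD.
have V0 := vol_ge0 mu L.
have bI B : bounded2 (L `&` B) by move=> y [/bL].
(* [a] is the centre, [c] its distance to the far face, [T] and [T'] the half-spaces bounded by the
   far and the near face and lying beyond them as seen from the other side. Bernoulli bounds the
   loss of the factor [l ^+ d]. *)
have key (l c : R) (T T' : set 'rV[R]_d) a : 0 < l -> D <= c -> l = 1 - e / c ->
    measurable_rV (L `&` T) -> measurable_rV (L `&` T') -> L a ->
    (forall y, T y -> T' (l *: y + (1 - l) *: a)) ->
    vol (L `&` T) - vol (L `&` T') <= d%:R * e / D * vol L.
  move=> l0 Dc lE mT mT' La h.
  have c0 : 0 < c by apply: lt_le_trans Dc.
  have ec : 0 <= e / c by rewrite divr_ge0 // ltW.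
  have l1 : 0 <= l <= 1 by lra.
  have H : l ^+ d * vol (L `&` T) <= vol (L `&` T').
    apply: (vol_homothety muV (v := (1 - l) *: a) l0) => //.
    by move=> y [Ly Ty]; split; [exact: cL|exact: h].
  have le : 1 - d%:R * (e / c) <= l ^+ d.
    by rewrite lE; apply: bernoulli_ineq; lra.
  have TL : vol (L `&` T) <= vol L by apply: (vol_le muV) => // y [].
  have T0 := vol_ge0 mu (L `&` T).
  have ecD : d%:R * (e / c) <= d%:R * e / D.
    by rewrite -mulrA ler_wpM2l // ler_wpM2l ?(ltW e0) // lef_pV2.
  have dc0 : 0 <= d%:R * (e / c) by rewrite mulr_ge0.
  apply: (@le_trans _ _ (d%:R * (e / c) * vol (L `&` T))).
    have := ler_wpM2r T0 le; lra.
  exact: ler_pM.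
(* If [y2] is not far above the slab, the gap [2 * D + e] puts [y1] far below it. *)
have [h|h] := leP (q + e + D) (dotp x y2); last first.
  pose c := q + e - dotp x y1.
  have Dc : D <= c by rewrite /c; lra.
  apply: (key (1 - e / c) c _ _ y1) => //.
  - by rewrite subr_gt0 ltr_pdivrMr ?mul1r /c; lra.
  - by apply: measurable_rVI => //; exact: measurable_rV_le.
  - by apply: measurable_rVI => //; exact: measurable_rV_le.
  move=> y /= hy; rewrite dotpDr !dotpZr.
  have c0 : 0 < c by lra.
  have l0 : 0 <= 1 - e / c by rewrite subr_ge0 ler_pdivrMr ?mul1r /c; lra.
  have ecc : e / c * c = e by rewrite divfK // gt_eqF.
  have := ler_wpM2l l0 hy.
  rewrite /c in ecc l0 c0 Dc *; lra.
pose c := dotp x y2 - q.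
have Dc : D <= c by rewrite /c; lra.
have := key (1 - e / c) c [set y | q < dotp x y] [set y | q + e < dotp x y] y2.
have := vol_split muV x q mL bL.
have := vol_split muV x (q + e) mL bL.
(* With the centre above the slab, the same estimate is applied to the upper half-spaces, the
   complements of the lower ones. *)
move=> E1 E2 K; suff : vol (L `&` [set y | q < dotp x y]) -
    vol (L `&` [set y | q + e < dotp x y]) <= d%:R * e / D * vol L by lra.
have c0 : 0 < c by lra.
have l0 : 0 < 1 - e / c by rewrite subr_gt0 ltr_pdivrMr ?mul1r /c; lra.
apply: K => //.
- by apply: measurable_rVI => //; exact: measurable_rV_gt.
- by apply: measurable_rVI => //; exact: measurable_rV_gt.
move=> y /= hy; rewrite dotpDr !dotpZr.
have ecc : e / c * c = e by rewrite divfK // gt_eqF.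
have : (1 - e / c) * q < (1 - e / c) * dotp x y by rewrite ltr_pM2l.
rewrite /c in ecc l0 c0 Dc *; lra.
Qed.

(** * Relaxed bodies and approximate median cuts *)

Definition body (z : R) K : set 'rV[R]_d :=
  cball 0 (1 + z) `&` [set y | forall c, c \in K -> dotp c.1 y <= c.2 + z].

Lemma measurable_rV_body z K : measurable_rV (body z K).
Proof.
apply: measurable_rVI; first exact: measurable_rV_ball.
elim: K => [|c K IH].
  rewrite (_ : [set _ | _] = setT) ?/measurable_rV ?preimage_setT //.
  by apply/seteqP; split => y.
rewrite (_ : [set _ | _] = [set y | dotp c.1 y <= c.2 + z] `&`
  [set y | forall c, c \in K -> dotp c.1 y <= c.2 + z]).
  by apply: measurable_rVI => //; exact: measurable_rV_le.
apply/seteqP; split => y /=.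
  move=> h; split; first by apply: h; rewrite mem_head.
  by move=> e eK; apply: h; rewrite inE eK orbT.
by move=> [h1 h2] e; rewrite inE => /orP[/eqP ->//|/h2].
Qed.

Lemma bodyE z K c :
  body z (c :: K) = body z K `&` [set y | dotp c.1 y <= c.2 + z].
Proof.
apply/seteqP; split => y /=.
  move=> [b h]; split; first split => //.
    by move=> e eK; apply: h; rewrite inE eK orbT.
  by apply: h; rewrite mem_head.
by move=> [[b h2] h1]; split => // e; rewrite inE => /orP[/eqP ->//|/h2].
Qed.

Lemma bounded_body z K : 0 <= z <= 1 -> bounded2 (body z K).
Proof.
move=> /andP[z0 z1] y [+ _]; rewrite /cball /= => /le_trans; apply.
by rewrite ler_pXn2r // ?nnegrE; lra.
Qed.

Lemma convex_body z K : is_convex (body z K).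
Proof.
move=> a y l [ba ha] [bY hy] /andP[l0 l1]; split; last first.
  move=> c cK; rewrite dotpDr !dotpZr.
  have l1' : 0 <= 1 - l by lra.
  have := ler_wpM2l l0 (hy c cK); have := ler_wpM2l l1' (ha c cK); lra.
move: ba bY; rewrite /cball /= !subr0 => ba bY.
have l1' : 0 <= 1 - l by lra.
have h := @dotp_le_sqr _ _ y a 1 ltr01; rewrite invr1 in h.
have h2 : 0 <= l * (1 - l) by rewrite mulr_ge0.
have h3 : dotp y a *+ 2 <= dotp y y + dotp a a by rewrite -mulr_natl; lra.
have h4 := ler_wpM2l h2 h3.
rewrite !(dotpDl, dotpDr, dotpZl, dotpZr) (dotpC a y).
have h5 := ler_wpM2l l0 bY; have h6 := ler_wpM2l l1' ba.
apply: (@le_trans _ _ (l * dotp y y + (1 - l) * dotp a a)); last by lra.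
lra.
Qed.

(** All prices on the favourable side of [m] are allowed, because the posted price is [m] after
    clamping. The pair [(- x, - p)] encodes the lower bound [p]. *)
Definition is_cut z K x (m : R) := forall p : R,
  (p <= m -> vol (body z ((x, p) :: K)) <= 3 / 4 * vol (body z K)) /\
  (m <= p -> vol (body z ((- x, - p) :: K)) <= 3 / 4 * vol (body z K)).

(** The median [m] is a supremum. Relaxed cuts on either side are compared with the levels [m + z]
    and [m - 2 * z]: at most half of the volume is below the lower level, more than half below the
    upper one, and at most a quarter between them. The extra [z] below absorbs the strict
    inequality. *)
Lemma cut_exists z K x y1 y2 : (0 < d)%N -> 0 < z <= 1 -> dotp x x <= 1 ->
  0 < vol (body z K) -> body z K y1 -> body z K y2 ->
  32 * d%:R * z <= dotp x y2 - dotp x y1 -> exists m, is_cut z K x m.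
Proof.
move=> d0 /andP[z0 z1] hx V0 B1 B2 hw.
set L := body z K in V0 B1 B2 *.
have mL : measurable_rV L := measurable_rV_body z K.
have bL : bounded2 L by apply: bounded_body; lra.
have cL : is_convex L := @convex_body z K.
have d1 : (1 : R) <= d%:R by rewrite ler1n.
pose f q := vol (L `&` [set y | dotp x y <= q]).
have mf q : measurable_rV (L `&` [set y | dotp x y <= q]).
  by apply: measurable_rVI => //; exact: measurable_rV_le.
have bI B : bounded2 (L `&` B) by move=> y [/bL].
have f_mono p q : p <= q -> f p <= f q.
  move=> pq; apply: (vol_le muV) => // y [Ly /= h]; split => //=.
  exact: le_trans pq.
have dL y : L y -> -2 <= dotp x y <= 2.
  move=> /bL; rewrite /cball /= subr0 => hy.
  have h1 := @dotp_le_sqr _ _ x y 2 (ltr0n _ 2).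
  have := @dotp_le_sqr _ _ (- x) y 2 (ltr0n _ 2).
  by rewrite !(dotpNl, dotpNr); lra.
have slab q : f (q + 3 * z) - f q <= vol L / 4.
  (* With [D = 12 * d * z] and [e = 3 * z], the slab bound [d * e / D] is a quarter, and [2 * D + e]
     is at most [27 * d * z], within the assumed gap. *)
  have dz : 0 < 12 * d%:R * z by rewrite !mulr_gt0 // ltr0n.
  have dz' : z <= d%:R * z by rewrite ler_peMl // ltW.
  apply: le_trans (slab_vol q mL bL cL B1 B2 _ dz (e := 3 * z) (x := x) _) _.
  - by rewrite mulr_gt0.
  - lra.
  rewrite mulrC ler_pM2l // (_ : _ / _ = 4^-1) //; field.
  by rewrite gt_eqF //= pnatr_eq0 -lt0n.
pose E := [set p | f p <= vol L / 2].
(* On the body [dotp x] ranges within [[-2, 2]], so the part below [-3] is empty and any level above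
   [2] leaves the whole body below. *)
have E3 : E (-3).
  rewrite /E /= (_ : f _ = 0) ?divr_ge0 ?(ltW V0) // /f.
  rewrite (_ : _ `&` _ = set0) ?/rV_volume ?preimage_set0 ?measure0 //.
  by apply/seteqP; split => y // [/dL /= h1 h2]; lra.
have Eb : has_ubound E.
  exists 2 => p Ep; rewrite leNgt; apply/negP => p2.
  move: Ep; rewrite /E /= /f (_ : _ `&` _ = L); first by lra.
  apply/seteqP; split => y; first by case.
  by move=> Ly; split => //=; have := dL _ Ly; lra.
have sE : has_sup E by split => //; exists (-3).
pose m := sup E; exists m.
have fm1 : f (m - 2 * z) <= vol L / 2.
  have z2 : 0 < 2 * z by rewrite mulr_gt0.
  have [p Ep pm] := sup_adherent z2 sE.
  by apply: le_trans Ep; apply: f_mono; exact: ltW.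
have fm2 : vol L / 2 < f (m + z).
  rewrite ltNge; apply/negP => h.
  have : m + z <= m by apply: ub_le_sup.
  lra.
have := slab (m - 2 * z); rewrite (_ : m - 2 * z + 3 * z = m + z); last by ring.
move=> hs p; rewrite !bodyE /= -/L; split => hp.
  have : f (p + z) <= f (m + z) by apply: f_mono; lra.
  rewrite -/(f (p + z)); lra.
have := vol_split muV x (m - 2 * z) mL bL.
rewrite -/(f _) => E1.
suff : vol (L `&` [set y | dotp (- x) y <= - p + z]) <=
       vol (L `&` [set y | m - 2 * z < dotp x y]) by lra.
apply: (vol_le muV) => //.
- by apply: measurable_rVI => //; exact: measurable_rV_le.
- by apply: measurable_rVI => //; exact: measurable_rV_gt.
- by move=> y [Ly /=]; rewrite dotpNl => h; split => //=; lra.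
Qed.

(** Normals have norm at most [1], so a displacement of length [z] shifts each constraint by at most
    [z], which is the relaxation. *)
Lemma body_ball z K v : 0 < z -> dotp v v <= 1 ->
  (forall c, c \in K -> dotp c.1 c.1 <= 1) ->
  body 0 K v -> cball v z `<=` body z K.
Proof.
move=> z0 hv hK [_ bv] y; rewrite /cball /= => hy.
pose u := z^-1 *: (y - v).
have yE : y = v + z *: u.
  by rewrite /u scalerA divff ?gt_eqF // scale1r addrC subrK.
have u1 : dotp u u <= 1.
  rewrite /u dotpZl dotpZr mulrA -invfM -expr2 mulrC ler_pdivrMr ?exprn_gt0 //.
  by rewrite mul1r.
clearbody u; split.
  rewrite /cball /= subr0 yE !(dotpDl, dotpDr, dotpZl, dotpZr) (dotpC u v).
  have h1 := ler_wpM2l (ltW z0) (dotp_ball hv u1).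
  have h2 : z * (z * dotp u u) <= z * z by rewrite ler_pM2l // ler_piMr // ltW.
  lra.
move=> c cK /=; rewrite yE dotpDr dotpZr.
have := bv c cK; rewrite addr0 => h.
have := ler_wpM2l (ltW z0) (dotp_ball (hK c cK) u1); lra.
Qed.

Lemma body_mono z z' K : 0 <= z <= z' -> body z K `<=` body z' K.
Proof.
move=> /andP[z0 zz] y [b h]; split; last by move=> c /h hc; lra.
move: b; rewrite /cball /= => /le_trans; apply.
by rewrite ler_pXn2r // ?nnegrE; lra.
Qed.

Lemma vol_body_ge z K v : 0 < z <= 1 -> dotp v v <= 1 ->
  (forall c, c \in K -> dotp c.1 c.1 <= 1) ->
  body 0 K v -> z ^+ d * vol (cball 0 1) <= vol (body z K).
Proof.
move=> /andP[z0 z1] hv hK bv; rewrite -(vol_cball muV v z0).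
apply: (vol_le muV); last exact: body_ball.
- exact: measurable_rV_ball.
- exact: measurable_rV_body.
- by apply: bounded_body; lra.
Qed.

Lemma vol_body_nil z : 0 < z ->
  vol (body z [::]) = (1 + z) ^+ d * vol (cball 0 1).
Proof.
move=> z0; rewrite -(vol_cball muV 0); last by lra.
congr (vol _); apply/seteqP; split => y; first by case.
by move=> h; split.
Qed.

Lemma vol_body_cons z c K : 0 < z <= 1 ->
  vol (body z (c :: K)) <= vol (body z K).
Proof.
move=> z01; apply: (vol_le muV); try exact: measurable_rV_body.
  by apply: bounded_body; lra.
by rewrite bodyE => y [].
Qed.

End Cuts.

(** * The policy and its potential *)

Section Algorithm.
Local Open Scope classical_set_scope.
Local Open Scope ring_scope.
Variables (R : realType) (d : nat) (d2 : (2 <= d)%N).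
Local Notation mR := (measurableTypeR R).
Variables (mu : {measure set (d.-tuple mR) -> \bar R}) (muV : is_volume mu).
Implicit Types (x y v s b : 'rV[R]_d) (K : seq ('rV[R]_d * R)).
Local Notation vol := (rV_volume mu).

Definition dyadic i : R := 2^-1 ^+ i.
(** Chosen so that [32 * d * margin i] is [dyadic i], the gap that [cut_exists] requires. *)
Definition margin i : R := dyadic i / (32 * d%:R).

Definition hi K x : R := sup [set dotp x y | y in body 0 K].
Definition lo K x : R := - hi K (- x).
Definition width K x : R := hi K x - lo K x.
(* For a nonempty [body 0 K], [scale_of] and [cut_point] take their default value
   only when the width is [0], and then the trade cannot be lost. *)
Definition scale_of (w : R) : nat :=
  xget 0%N [set i | dyadic i < w <= 2 * dyadic i].
Definition cut_point K x : R :=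
  xget 0 [set m | is_cut mu (margin (scale_of (width K x))) K x m].

Definition consistent K v :=
  dotp v v <= 1 /\ forall c, c \in K -> dotp c.1 c.1 <= 1 /\ dotp c.1 v <= c.2.

Let d0 : (0 < d)%N. Proof. exact: leq_trans d2. Qed.
Let d0R : (0 : R) < d%:R. Proof. by rewrite ltr0n. Qed.

Lemma dyadic_gt0 i : 0 < dyadic i.
Proof. by rewrite exprn_gt0. Qed.

Lemma margin_bounds i : 0 < margin i <= 1.
Proof.
have d32 : 0 < 32 * (d%:R : R) by rewrite mulr_gt0.
apply/andP; split; first by rewrite divr_gt0 ?dyadic_gt0.
rewrite ler_pdivrMr // mul1r; apply: (@le_trans _ _ 1).
  by apply: exprn_ile1; lra.
have : (1 : R) <= d%:R by rewrite ler1n.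
lra.
Qed.

Lemma consistent_body K v : consistent K v -> body 0 K v.
Proof.
move=> [v1 h]; split; first by rewrite /cball /= subr0 addr0 expr1n.
by move=> c /h[_ hc]; rewrite addr0.
Qed.

Lemma dotp_body0 K x y : dotp x x <= 1 -> body 0 K y -> dotp x y <= 1.
Proof.
by move=> x1 [+ _]; rewrite /cball /= subr0 addr0 expr1n; exact: dotp_ball.
Qed.

Lemma le_hi K x v : dotp x x <= 1 -> body 0 K v -> dotp x v <= hi K x.
Proof.
move=> x1 bv; apply: ub_le_sup; last by exists v.
by exists 1 => _ [y bY <-]; exact: dotp_body0 bY.
Qed.

Lemma hi_le1 K x v : dotp x x <= 1 -> body 0 K v -> hi K x <= 1.
Proof.
move=> x1 bv; apply: ge_sup; first by exists (dotp x v), v.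
by move=> _ [y bY <-]; exact: dotp_body0 bY.
Qed.

Lemma dotpNlr x : dotp (- x) (- x) = dotp x x.
Proof. by rewrite dotpNl dotpNr opprK. Qed.

Lemma lo_le K x v : dotp x x <= 1 -> body 0 K v -> lo K x <= dotp x v.
Proof.
move=> x1 bv; rewrite /lo lerNl -dotpNl; apply: le_hi => //.
by rewrite dotpNlr.
Qed.

Lemma width_le2 K x v : dotp x x <= 1 -> body 0 K v -> width K x <= 2.
Proof.
move=> x1 bv; rewrite /width /lo opprK.
have := hi_le1 x1 bv; have x1' : dotp (- x) (- x) <= 1 by rewrite dotpNlr.
by have := hi_le1 x1' bv; lra.
Qed.

Lemma hi_adherent K x v e : dotp x x <= 1 -> body 0 K v -> 0 < e ->
  exists2 y, body 0 K y & hi K x - e < dotp x y.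
Proof.
move=> x1 bv e0.
have [|_ [y bY <-] h] := @sup_adherent _ [set dotp x y | y in body 0 K] e e0.
  split; first by exists (dotp x v), v.
  by exists 1 => _ [y bY <-]; exact: dotp_body0 bY.
by exists y.
Qed.

Lemma width_witness K x v (w : R) :
  dotp x x <= 1 -> body 0 K v -> w < width K x ->
  exists y1 y2, [/\ body 0 K y1, body 0 K y2 & w <= dotp x y2 - dotp x y1].
Proof.
move=> x1 bv hw; pose e := (width K x - w) / 2.
have e0 : 0 < e by rewrite divr_gt0 // subr_gt0.
have x1' : dotp (- x) (- x) <= 1 by rewrite dotpNlr.
have [y2 b2 h2] := hi_adherent x1 bv e0.
have [y1 b1 h1] := hi_adherent x1' bv e0.
exists y1, y2; split => //; move: h1 h2; rewrite dotpNl /e /width /lo; lra.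
Qed.

(** The least [i] with [dyadic i < w] works: minimality gives the upper bound, except at [i = 0],
    where it is the assumption [w <= 2]. *)
Lemma scale_ofP (w : R) : 0 < w <= 2 ->
  dyadic (scale_of w) < w <= 2 * dyadic (scale_of w).
Proof.
move=> /andP[w0 w2]; rewrite /scale_of.
suff [i hi] : exists i, dyadic i < w <= 2 * dyadic i.
  by case: xgetP => // /(_ i).
have ex : exists i, dyadic i < w.
  exists (Num.truncn w^-1).+1.
  rewrite /dyadic exprVn invf_plt ?posrE ?exprn_gt0 //.
  apply: lt_le_trans (truncnS_gt _) _; rewrite -natrX ler_nat.
  by apply/ltnW/ltn_expl.
have [i hi mini] := ex_minnP ex; exists i; rewrite hi /=.
case: i hi mini => [|i] hi mini; first by rewrite /dyadic expr0 mulr1.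
rewrite /dyadic exprS mulrA divff // mul1r leNgt; apply/negP => /mini.
by rewrite ltnn.
Qed.

(** Points nearly attaining the width lie in the unrelaxed body, hence in the relaxed one, and are
    [dyadic i] apart; consistency gives positive volume. *)
Lemma cut_pointP K v x : consistent K v -> dotp x x <= 1 -> 0 < width K x ->
  is_cut mu (margin (scale_of (width K x))) K x (cut_point K x).
Proof.
move=> cK x1 w0; rewrite /cut_point; set i := scale_of _.
have bv := consistent_body cK.
have [m hm] : exists m, is_cut mu (margin i) K x m.
  have hw : 0 < width K x <= 2 by rewrite w0 (width_le2 x1 bv).
  have /andP[hi _] := scale_ofP hw.
  have [y1 [y2 [b1 b2 h]]] := width_witness x1 bv hi.
  have zb := margin_bounds i; have /andP[z0 z1] := zb.
  have bm : body 0 K `<=` body (margin i) K.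
    by apply: body_mono; rewrite lexx ltW.
  apply: (cut_exists muV d0 zb x1 _ (bm _ b1) (bm _ b2)).
    have := vol_body_ge muV zb cK.1 (fun c h => (cK.2 c h).1) bv.
    apply: lt_le_trans; rewrite mulr_gt0 ?exprn_gt0 //.
    exact: vol_unit_ball_gt0.
  by rewrite /margin mulrC divfK // mulf_neq0 // ?gt_eqF.
by case: xgetP => // /(_ m).
Qed.

(** The reference is the volume of a ball of radius [margin i], a lower bound for every consistent
    list, so the logarithm is nonnegative. *)
Definition logvol i K : R :=
  ln (vol (body (margin i) K) / (margin i ^+ d * vol (cball 0 1))).

(* A factor [3/4] lowers [logvol] by at least [1/4], so the weight [8 * dyadic i]
   pays [2 * dyadic i], which bounds every width of scale [i]. *)
Definition potential M K : R := \sum_(i < M) 8 * dyadic i * logvol i K.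

Let base_gt0 i : 0 < margin i ^+ d * vol (cball 0 1).
Proof.
have /andP[z0 _] := margin_bounds i.
by rewrite mulr_gt0 ?exprn_gt0 ?(vol_unit_ball_gt0 muV).
Qed.

Lemma vol_margin_ge i K v : consistent K v ->
  margin i ^+ d * vol (cball 0 1) <= vol (body (margin i) K).
Proof.
move=> cK.
apply: (vol_body_ge muV (margin_bounds i) cK.1 _ (consistent_body cK)).
by move=> c /cK.2[].
Qed.

Lemma vol_margin_gt0 i K v : consistent K v -> 0 < vol (body (margin i) K).
Proof. by move=> cK; apply: lt_le_trans (vol_margin_ge i cK). Qed.

Lemma logvol_ge0 i K v : consistent K v -> 0 <= logvol i K.
Proof.
move=> cK; rewrite /logvol ln_ge0 // ler_pdivlMr // mul1r.
exact: vol_margin_ge cK.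
Qed.

Lemma potential_ge0 M K v : consistent K v -> 0 <= potential M K.
Proof.
move=> cK; apply: sumr_ge0 => i _.
by rewrite !mulr_ge0 // ?(ltW (dyadic_gt0 _)) // (logvol_ge0 _ cK).
Qed.

Lemma consistent_tail c K v : consistent (c :: K) v -> consistent K v.
Proof. by move=> [v1 h]; split => // e eK; apply: h; rewrite inE eK orbT. Qed.

Lemma logvol_cons i c K v : consistent (c :: K) v ->
  logvol i (c :: K) <= logvol i K.
Proof.
move=> cK; have cK' := consistent_tail cK.
have h1 := vol_margin_gt0 i cK; have h2 := vol_margin_gt0 i cK'.
rewrite /logvol ler_ln ?posrE ?divr_gt0 // ler_pM2r ?invr_gt0 //.
by apply: (vol_body_cons muV); exact: margin_bounds.
Qed.

Lemma logvol_drop i c K v : consistent (c :: K) v ->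
  vol (body (margin i) (c :: K)) <= 3 / 4 * vol (body (margin i) K) ->
  logvol i (c :: K) <= logvol i K - 1 / 4.
Proof.
move=> cK; have cK' := consistent_tail cK.
have h1 := vol_margin_gt0 i cK; have h2 := vol_margin_gt0 i cK' => h.
have q0 : (0 : R) < 3 / 4 by lra.
apply: (@le_trans _ _ (ln (3 / 4 *
    (vol (body (margin i) K) / (margin i ^+ d * vol (cball 0 1)))))).
  rewrite /logvol ler_ln ?posrE ?divr_gt0 // ?mulr_gt0 ?invr_gt0 //.
  by rewrite mulrA ler_pM2r ?invr_gt0.
rewrite lnM ?posrE ?divr_gt0 // addrC lerD2l.
(* The inequality [ln (1 + t) <= t] at [t = - (1 / 4)]. *)
have := @le_ln1Dx R (- (1 / 4)).
rewrite (_ : 1 + - (1 / 4) = 3 / 4); last by field.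
by apply; lra.
Qed.

Lemma potential_cons M c K v : consistent (c :: K) v ->
  potential M (c :: K) <= potential M K.
Proof.
move=> cK; apply: ler_sum => i _; apply: ler_wpM2l; last exact: logvol_cons cK.
by rewrite mulr_ge0 // ltW // dyadic_gt0.
Qed.

Lemma potential_drop M c K v (i : nat) : consistent (c :: K) v -> (i < M)%N ->
  vol (body (margin i) (c :: K)) <= 3 / 4 * vol (body (margin i) K) ->
  potential M (c :: K) + 2 * dyadic i <= potential M K.
Proof.
move=> cK iM h; rewrite /potential.
rewrite (bigD1 (Ordinal iM)) //= [leRHS](bigD1 (Ordinal iM)) //=.
have h0 := dyadic_gt0 i.
have h1 := ler_wpM2l (ltW h0) (logvol_drop cK h).
set S1 := \sum_(j < M | _) _; set S2 := \sum_(j < M | _) _.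
suff : S1 <= S2 by lra.
apply: ler_sum => j _; apply: ler_wpM2l; last exact: logvol_cons cK.
by rewrite mulr_ge0 // ltW // dyadic_gt0.
Qed.

(** [l] stands for the loss of a round: it is at most the width, hence at most [2 * dyadic i] at the
    scale [i] of that width, which the potential pays. *)
Lemma charge_le M K v x (p l : R) : consistent ((x, p) :: K) v ->
  dotp x x <= 1 -> (scale_of (width K x) < M)%N ->
  0 < l <= width K x -> p <= cut_point K x ->
  potential M ((x, p) :: K) + l <= potential M K.
Proof.
move=> cK x1 iM /andP[l0 lw] pm; have cK' := consistent_tail cK.
have w0 : 0 < width K x by apply: lt_le_trans lw.
have hw : 0 < width K x <= 2 by rewrite w0 (width_le2 x1 (consistent_body cK')).
have /andP[_ hs] := scale_ofP hw.
have [h _] := cut_pointP cK' x1 w0 p.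
have := potential_drop cK iM (h pm); lra.
Qed.

Lemma charge_ge M K v x (p l : R) : consistent ((- x, - p) :: K) v ->
  dotp x x <= 1 -> (scale_of (width K x) < M)%N ->
  0 < l <= width K x -> cut_point K x <= p ->
  potential M ((- x, - p) :: K) + l <= potential M K.
Proof.
move=> cK x1 iM /andP[l0 lw] pm; have cK' := consistent_tail cK.
have w0 : 0 < width K x by apply: lt_le_trans lw.
have hw : 0 < width K x <= 2 by rewrite w0 (width_le2 x1 (consistent_body cK')).
have /andP[_ hs] := scale_ofP hw.
have [_ h] := cut_pointP cK' x1 w0 p.
have := potential_drop cK iM (h pm); lra.
Qed.

Lemma dyadic_sum M :
  \sum_(i < M) dyadic i * (7 + i%:R) = 16 - dyadic M * (2 * M%:R + 16).
Proof.
elim: M => [|M IH]; first by rewrite big_ord0 /dyadic expr0; ring.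
rewrite big_ord_recr /= IH /dyadic exprSr -natr1.
by move: (2^-1 ^+ M) => h; field.
Qed.

(** The bound does not depend on [M]. The assumption [2 <= d] lets [ln d] absorb [ln 2], and the
    series of [dyadic i * (7 + i)] sums to [16], whence [8 * 16 = 128]. *)
Lemma potential_nil M : potential M [::] <= 128 * d%:R * ln d%:R.
Proof.
have ld : ln 2 <= ln (d%:R : R) by rewrite ler_ln ?posrE // ler_nat.
have l2 : 0 <= ln (2 : R) by rewrite ln_ge0 // ler1n.
have step i : logvol i [::] <= d%:R * ((7 + i%:R) * ln d%:R).
  have /andP[z0 z1] := margin_bounds i.
  rewrite /logvol (vol_body_nil muV z0) -mulf_div divff; last first.
    by rewrite gt_eqF ?vol_unit_ball_gt0.
  rewrite mulr1 -expr_div_n lnXn; last by rewrite divr_gt0 //; lra.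
  rewrite -[leLHS]mulr_natl ler_pM2l //.
  (* [(1 + z) / z] is at most [2 / z], which for [z = margin i] equals [64 * d * 2 ^ i]. *)
  apply: (@le_trans _ _ (ln (d%:R * 2 ^+ (6 + i)))).
    have q1 : 0 < (1 + margin i) / margin i by rewrite divr_gt0 //; lra.
    have q2 : 0 < d%:R * 2 ^+ (6 + i) :> R by rewrite mulr_gt0 ?exprn_gt0.
    rewrite ler_ln ?posrE //.
    rewrite ler_pdivrMr //; apply: (@le_trans _ _ 2); first by lra.
    rewrite /margin /dyadic exprVn exprD.
    rewrite (_ : (2 : R) ^+ 6 = 64); last by rewrite -natrX.
    rewrite le_eqVlt; apply/orP; left; apply/eqP; field.
    by rewrite gt_eqF ?exprn_gt0 //= gt_eqF.
  rewrite lnM ?posrE ?exprn_gt0 // lnXn // -[ln 2 *+ _]mulr_natl natrD.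
  have : (6%:R + i%:R) * ln 2 <= (6%:R + i%:R) * ln (d%:R : R).
    by rewrite ler_wpM2l // addr_ge0.
  lra.
apply: (@le_trans _ _ (8 * d%:R * ln d%:R *
    \sum_(i < M) dyadic i * (7 + i%:R))).
  rewrite /potential mulr_sumr; apply: ler_sum => i _.
  have h0 : 0 <= 8 * dyadic i by rewrite mulr_ge0 // ltW // dyadic_gt0.
  by have := ler_wpM2l h0 (step i); lra.
rewrite dyadic_sum.
have c0 : 0 <= 8 * d%:R * ln (d%:R : R) by rewrite !mulr_ge0 //; lra.
have e0 : 0 <= dyadic M * (2 * M%:R + 16).
  by rewrite mulr_ge0 ?(ltW (dyadic_gt0 _)) // addr_ge0 // mulr_ge0.
have := mulr_ge0 c0 e0; lra.
Qed.

(** * The policy, and charging each loss to the potential *)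

Definition state := (seq ('rV[R]_d * R) * seq ('rV[R]_d * R))%type.
Implicit Type st : state.

(** The outer clamp comes from the narrower body. When it is active, the agent of that body is sure
    to accept. *)
Definition price st x : R :=
  if width st.1 x <= width st.2 x
  then Num.min (hi st.1 x) (Num.max (cut_point st.2 x) (lo st.2 x))
  else Num.max (lo st.2 x) (Num.min (cut_point st.1 x) (hi st.1 x)).

Definition record_le K x (p : R) (le : bool) :=
  (if le then (x, p) else (- x, - p)) :: K.

(** A buyer who refuses has a value below the price, hence the negated bit. Strict inequalities are
    recorded as weak ones. *)
Definition update st (o : 'rV[R]_d * (bool * bool)) : state :=
  let p := price st o.1 in
  (record_le st.1 o.1 p o.2.1, record_le st.2 o.1 p (~~ o.2.2)).

Lemma consistent_record_le K v x (p : R) le : consistent K v -> dotp x x <= 1 ->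
  (if le then dotp v x <= p else p <= dotp v x) ->
  consistent (record_le K x p le) v.
Proof.
move=> [v1 h] x1 hp; split => // c; rewrite inE => /orP[/eqP ->|/h//].
by case: le hp => /= hp; rewrite ?dotpNlr dotpC ?dotpNr ?lerN2.
Qed.

Definition next_state st s b x : state :=
  update st (x, feedback (dotp s x) (dotp b x) (price st x) (price st x)).

Lemma next_state_consistent st s b x : consistent st.1 s -> consistent st.2 b ->
  dotp x x <= 1 ->
  consistent (next_state st s b x).1 s /\ consistent (next_state st s b x).2 b.
Proof.
move=> cs cb x1; rewrite /next_state /update /=; move: (price st x) => p; split.
  by apply: consistent_record_le => //; case: leP => // /ltW.
by apply: consistent_record_le => //; case: (leP p) => //= /ltW.
Qed.

(** A round costs something only if [dotp s x < dotp b x] and one agent refuses; the other then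
    accepts. In each of the four cases (who refuses, which body is wider) the wider body is cut on
    the favourable side of its median and its width bounds the loss. *)
Lemma round_regret M st s b x : consistent st.1 s -> consistent st.2 b ->
  dotp x x <= 1 -> (scale_of (width st.1 x) < M)%N ->
  (scale_of (width st.2 x) < M)%N ->
  Num.max (dotp b x - dotp s x) 0
    - GFT (dotp s x) (dotp b x) (price st x) (price st x)
    + potential M (next_state st s b x).1 + potential M (next_state st s b x).2
  <= potential M st.1 + potential M st.2.
Proof.
move=> cs cb x1 iMs iMb.
have [cs' cb'] := next_state_consistent cs cb x1.
have us : potential M (next_state st s b x).1 <= potential M st.1.
  exact: potential_cons cs'.
have ub : potential M (next_state st s b x).2 <= potential M st.2.
  exact: potential_cons cb'.
have bs := consistent_body cs; have bb := consistent_body cb.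
have hs := le_hi x1 bs; have ls := lo_le x1 bs.
have hb := le_hi x1 bb; have lb := lo_le x1 bb.
rewrite (dotpC x s) in hs ls; rewrite (dotpC x b) in hb lb.
move: cs' cb' us ub; rewrite /next_state /update /= /feedback /record_le.
have [p pE] : exists p, p = price st x by exists (price st x).
rewrite -pE /GFT => cs' cb' us ub.
case: ifP => [/andP[sp pb]|lost].
  by rewrite mulr1 max_l ?subr_ge0 ?(le_trans sp pb) // subrr add0r lerD.
rewrite mulr0 subr0.
have [sb|] := leP (dotp b x - dotp s x) 0; first by rewrite add0r lerD.
rewrite subr_gt0 => sb.
have charge_s (H : potential M ((if dotp s x <= p then (x, p) else (- x, - p))
    :: st.1) + (dotp b x - dotp s x) <= potential M st.1) :
  dotp b x - dotp s x +
  potential M ((if dotp s x <= p then (x, p) else (- x, - p)) :: st.1) +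
  potential M ((if ~~ (p <= dotp b x) then (x, p) else (- x, - p)) :: st.2) <=
  potential M st.1 + potential M st.2.
  by rewrite (addrC (dotp b x - _)) lerD.
have charge_b (H : potential M ((if ~~ (p <= dotp b x) then (x, p)
    else (- x, - p)) :: st.2) + (dotp b x - dotp s x) <= potential M st.2) :
  dotp b x - dotp s x +
  potential M ((if dotp s x <= p then (x, p) else (- x, - p)) :: st.1) +
  potential M ((if ~~ (p <= dotp b x) then (x, p) else (- x, - p)) :: st.2) <=
  potential M st.1 + potential M st.2.
  by rewrite addrAC (addrC (dotp b x - _)) addrC lerD.
have l0 : 0 < dotp b x - dotp s x by rewrite subr_gt0.
have [sp|ps] := leP (dotp s x) p; rewrite ?sp ?(lt_geF ps) /= in
  lost cs' charge_s charge_b.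
  have bp : dotp b x < p by rewrite ltNge lost.
  rewrite (lt_geF bp) /= in cb' charge_s charge_b; rewrite (lt_geF bp) /=.
  move: pE; rewrite /price; case: leP => hw pE.
    (* The buyer refuses and the body of [b] is wider: [p] is at most the greatest seller value, so
       the narrower width already bounds the loss. As [p] exceeds the least buyer value, it is at
       most the median. *)
    apply: charge_b; apply: (charge_le cb' x1 iMb).
      rewrite l0 (le_trans _ hw) // lerB // (le_trans (ltW bp)) //.
      by rewrite pE ge_min lexx.
    have : p <= Num.max (cut_point st.2 x) (lo st.2 x).
      by rewrite pE ge_min lexx orbT.
    by rewrite le_max => /orP[//|]; rewrite leNgt (le_lt_trans lb bp).
  (* The outer clamp is inactive, since the buyer refused a price above the least possible buyer
     value. *)
  have {}pE : p = Num.min (cut_point st.1 x) (hi st.1 x).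
    by move: pE; rewrite maxEle; case: ifP => // _ pE; rewrite pE ltNge lb in bp.
  apply: charge_s; apply: (charge_le cs' x1 iMs).
    rewrite l0 lerB // (le_trans (ltW bp)) //.
    by rewrite pE ge_min lexx orbT.
  by rewrite pE ge_min lexx.
have pb : p <= dotp b x by rewrite ltW // (lt_trans ps sb).
rewrite pb /= in cb' charge_s charge_b; rewrite pb /=.
move: pE; rewrite /price; case: leP => hw pE.
  (* The outer clamp is inactive: the seller refused, so [p] is below the greatest possible seller
     value. *)
  have {}pE : p = Num.max (cut_point st.2 x) (lo st.2 x).
    by move: pE; rewrite minEle; case: ifP => // _ pE; rewrite pE ltNge hs in ps.
  apply: charge_b; apply: (charge_ge cb' x1 iMb).
    rewrite l0 lerB // (le_trans _ (ltW ps)) //.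
    by rewrite pE le_max lexx orbT.
  by rewrite pE le_max lexx.
(* Here [p] is at least the least buyer value, so the width of the body of [b] bounds the loss, and
   the body of [s] is wider. *)
apply: charge_s; apply: (charge_ge cs' x1 iMs).
  rewrite l0 (le_trans _ (ltW hw)) // lerB // (le_trans _ (ltW ps)) //.
  by rewrite pE le_max lexx.
have : Num.min (cut_point st.1 x) (hi st.1 x) <= p.
  by rewrite pE le_max lexx orbT.
by rewrite ge_min => /orP[//|]; rewrite leNgt (lt_le_trans ps hs).
Qed.

Definition trade_policy : policy R d := fun h x =>
  let p := price (foldl update ([::], [::]) h) x in (p, p).

Lemma trade_policy_regret T s b (x : nat -> 'rV[R]_d) :
  in_ball s -> in_ball b ->
  (forall k, in_ball (x k)) ->
  total_regret trade_policy s b x T <= 256 * d%:R * ln d%:R.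
Proof.
move=> /in_ballE s1 /in_ballE b1 xb.
have x1 k : dotp (x k) (x k) <= 1 by apply/in_ballE.
pose st t := foldl update ([::], [::]) (hist trade_policy s b x t).
have stS t : st t.+1 = next_state (st t) s b (x t).
  by rewrite /st /= foldl_rcons.
have cons t : consistent (st t).1 s /\ consistent (st t).2 b.
  elim: t => [|t [cs cb]]; first by split; split.
  by rewrite stS; exact: next_state_consistent.
pose sc t := maxn (scale_of (width (st t).1 (x t)))
  (scale_of (width (st t).2 (x t))).
(* The number of scales may depend on the instance and on [T], because the initial potential is
   bounded uniformly in [M]. *)
pose M := (\max_(t < T) sc t).+1.
have scM t : (t < T)%N -> (sc t < M)%N.
  by move=> tT; rewrite ltnS; exact: (leq_bigmax (Ordinal tT)).
have telescope t : (t <= T)%N ->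
    total_regret trade_policy s b x t + potential M (st t).1 +
    potential M (st t).2 <= potential M [::] + potential M [::].
  elim: t => [_|t IH tT].
    by rewrite /total_regret big_ord0 add0r.
  apply: le_trans (IH (ltnW tT)).
  have [cs cb] := cons t; have := scM t tT; rewrite gtn_max => /andP[i1 i2].
  have := round_regret cs cb (x1 t) i1 i2; rewrite -stS => h.
  by rewrite /total_regret big_ord_recr /= -!addrA lerD2l !addrA; exact: h.
have [c1 c2] := cons T; have := telescope T (leqnn T).
have := potential_ge0 M c1; have := potential_ge0 M c2.
have := potential_nil M; lra.
Qed.

End Algorithm.

(* A (possibly randomized) algorithm is a probability space (Omega, P) of
   internal random seeds together with, for each seed, a deterministic policy
   whose prices depend measurably on the seed. *)
Theorem theorem4p2 :
  exists C : nat,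
  forall (R : realType) (d : nat), (2 <= d)%N ->
  exists (dsp : measure_display) (Omega : measurableType dsp)
         (P : probability Omega R) (alg : Omega -> policy R d),
    (* measurability of the randomized decisions in the seed *)
    (forall (h : history R d) (v : 'rV[R]_d),
        measurable_fun setT (fun w => (alg w h v).1) /\
        measurable_fun setT (fun w => (alg w h v).2)) /\
    (* per-round budget balance: p_t <= q_t for every round, seed and instance *)
    (forall (s b : 'rV[R]_d) (x : nat -> 'rV[R]_d) (t : nat) (w : Omega),
        in_ball s -> in_ball b -> (forall k, in_ball (x k)) ->
        (prices (alg w) s b x t).1 <= (prices (alg w) s b x t).2) /\
    (* regret bound O(d log d), uniformly over horizons and instances *)
    (forall (T : nat) (s b : 'rV[R]_d) (x : nat -> 'rV[R]_d),
        in_ball s -> in_ball b -> (forall k, in_ball (x k)) ->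
        (\int[P]_(w in setT) (total_regret (alg w) s b x T)%:E
           <= (C%:R * d%:R * ln (d%:R : R))%:E)%E).
Proof.
exists 256%N => R d d2.
have [mu muV] := volume_exists R d.
(* A one-point seed space, since the policy is deterministic; both prices are equal, which gives
   budget balance. *)
exists _, unit, (\d_tt), (fun _ => trade_policy mu); split; last split.
- by move=> h v; split; exact: measurable_cst.
- by [].
move=> T s b x hs hb hx.
rewrite (integral_cst _ measurableT) /= diracT mule1 lee_fin.
exact: trade_policy_regret.
Qed.
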